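(* Let $k_0$ be a field. The algebra of additive operations $\varphi:K^M_i\to K^M_*$ over $k_0$ is the free $K^M_*(k_0)$-module generated by the identity map. In other words, given an additive operation $\varphi$ over $k_0$, there exists $a\in K^M_*(k_0)$ such that for all fields $k/k_0$ and all $x\in K^M_i(k)$, $\varphi(x)=a\cdot x$.
   Context: $K^M_*(k)=\bigoplus_{n\ge0}K^M_n(k)$ is the (integral) Milnor $K$-ring of the field $k$, and $K^M_i(k)$ ($i\ge0$) its degree $i$ part. An operation $\varphi:K^M_i\to K^M_*$ over $k_0$ is a family of functions $K^M_i(k)\to K^M_*(k)$, one for each field extension $k/k_0$, compatible with field extensions over $k_0$. It is additive if $\varphi(x+y)=\varphi(x)+\varphi(y)$ for all $k/k_0$ and all $x,y\in K^M_i(k)$. The set of additive operations is a module over $K^M_*(k_0)$ via $(a\cdot\varphi)(x)=a_k\cdot\varphi(x)$, with $a_k$ the image of $a$ in $K^M_*(k)$ (written simply $a\cdot x$ in the claim when $\varphi$ is the identity map). *)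

(* Defs.v *)
From HB Require Import structures.
From mathcomp Require Import all_boot all_order all_algebra.
From mathcomp Require Import boolp.

Set Implicit Arguments.
Unset Strict Implicit.
Unset Printing Implicit Defensive.

Import GRing.Theory.
Local Open Scope ring_scope.
Local Open Scope quotient_scope.

(* k^*, for a possibly infinite field k. *)
Definition nz (k : fieldType) := {a : k | a != 0}.

Section MilnorRing.
Variable k : fieldType.

(* The Milnor K-ring is the tensor algebra of the abelian group k^* modulo the
   two-sided ideal generated by the a (x) (1 - a), that is, the associative
   unital ring generated by symbols {a}, a in k^*, subject to
   {ab} = {a} + {b} and to {a}{b} = 0 whenever a + b = 1.  It is built as the
   ring expressions in the symbols modulo the congruence generated by the ring
   axioms and these two families of relations. *)
Inductive Kterm : Type :=
| Kzero | Kone | Ksym of nz k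
| Kopp of Kterm | Kadd of Kterm & Kterm | Kmul of Kterm & Kterm.

Inductive Kcong : Kterm -> Kterm -> Prop :=
| Kc_refl x : Kcong x x
| Kc_sym x y : Kcong x y -> Kcong y x
| Kc_trans x y z : Kcong x y -> Kcong y z -> Kcong x z
| Kc_opp x x' : Kcong x x' -> Kcong (Kopp x) (Kopp x')
| Kc_add x x' y y' : Kcong x x' -> Kcong y y' -> Kcong (Kadd x y) (Kadd x' y')
| Kc_mul x x' y y' : Kcong x x' -> Kcong y y' -> Kcong (Kmul x y) (Kmul x' y')
| Kc_addA x y z : Kcong (Kadd x (Kadd y z)) (Kadd (Kadd x y) z)
| Kc_addC x y : Kcong (Kadd x y) (Kadd y x)
| Kc_add0 x : Kcong (Kadd Kzero x) x
| Kc_addN x : Kcong (Kadd (Kopp x) x) Kzero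
| Kc_mulA x y z : Kcong (Kmul x (Kmul y z)) (Kmul (Kmul x y) z)
| Kc_mul1l x : Kcong (Kmul Kone x) x
| Kc_mul1r x : Kcong (Kmul x Kone) x
| Kc_mulDl x y z : Kcong (Kmul (Kadd x y) z) (Kadd (Kmul x z) (Kmul y z))
| Kc_mulDr x y z : Kcong (Kmul x (Kadd y z)) (Kadd (Kmul x y) (Kmul x z))
| Kc_symM (a b c : nz k) : val c = val a * val b ->
    Kcong (Ksym c) (Kadd (Ksym a) (Ksym b))
| Kc_steinberg (a b : nz k) : val a + val b = 1 ->
    Kcong (Kmul (Ksym a) (Ksym b)) Kzero.

HB.instance Definition _ := gen_eqMixin Kterm.
HB.instance Definition _ := gen_choiceMixin Kterm.

Definition Keqv : rel Kterm := fun x y => `[< Kcong x y >].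

Lemma Keqv_refl : reflexive Keqv.
Proof. by move=> x; apply/asboolP; apply: Kc_refl. Qed.

Lemma Keqv_sym : symmetric Keqv.
Proof. by move=> x y; apply/asboolP/asboolP; apply: Kc_sym. Qed.

Lemma Keqv_trans : transitive Keqv.
Proof.
by move=> y x z /asboolP xy /asboolP yz; apply/asboolP; apply: Kc_trans yz.
Qed.

Canonical Keqv_equiv := EquivRel Keqv Keqv_refl Keqv_sym Keqv_trans.

Definition milnorK := {eq_quot Keqv}.

HB.instance Definition _ := Choice.on milnorK.
HB.instance Definition _ := EqQuotient.on milnorK.

Definition Kclass (t : Kterm) : milnorK := \pi_milnorK t.

Lemma milnorK_eq (t u : Kterm) :
  Kcong t u <-> Kclass t = Kclass u.
Proof.
split; first by move=> tu; apply/eqquotP/asboolP.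
by move/eqquotP/asboolP.
Qed.

Lemma milnorK_repr (t : Kterm) : Kcong (repr (Kclass t)) t.
Proof. by apply/milnorK_eq; rewrite /Kclass reprK. Qed.

Lemma KclassW (P : milnorK -> Prop) :
  (forall t, P (Kclass t)) -> forall x, P x.
Proof. by move=> Pt; elim/quotW. Qed.

Definition Kaddition (x y : milnorK) := Kclass (Kadd (repr x) (repr y)).
Definition Kopposite (x : milnorK) := Kclass (Kopp (repr x)).
Definition Kproduct (x y : milnorK) := Kclass (Kmul (repr x) (repr y)).

Lemma KaddE t u : Kaddition (Kclass t) (Kclass u) = Kclass (Kadd t u).
Proof. by apply/milnorK_eq; apply: Kc_add; apply: milnorK_repr. Qed.

Lemma KoppE t : Kopposite (Kclass t) = Kclass (Kopp t).
Proof. by apply/milnorK_eq; apply: Kc_opp; apply: milnorK_repr. Qed.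

Lemma KmulE t u : Kproduct (Kclass t) (Kclass u) = Kclass (Kmul t u).
Proof. by apply/milnorK_eq; apply: Kc_mul; apply: milnorK_repr. Qed.

Let KaddA : associative Kaddition.
Proof.
elim/KclassW=> x; elim/KclassW=> y; elim/KclassW=> z.
by rewrite !KaddE; apply/milnorK_eq; apply: Kc_addA.
Qed.

Let KaddC : commutative Kaddition.
Proof.
elim/KclassW=> x; elim/KclassW=> y.
by rewrite !KaddE; apply/milnorK_eq; apply: Kc_addC.
Qed.

Let Kadd0l : left_id (Kclass Kzero) Kaddition.
Proof. by elim/KclassW=> x; rewrite KaddE; apply/milnorK_eq; apply: Kc_add0. Qed.

Let KaddN : left_inverse (Kclass Kzero) Kopposite Kaddition.
Proof.
by elim/KclassW=> x; rewrite KoppE KaddE; apply/milnorK_eq; apply: Kc_addN.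
Qed.

HB.instance Definition _ :=
  GRing.isZmodule.Build milnorK KaddA KaddC Kadd0l KaddN.

Let KmulA : associative Kproduct.
Proof.
elim/KclassW=> x; elim/KclassW=> y; elim/KclassW=> z.
by rewrite !KmulE; apply/milnorK_eq; apply: Kc_mulA.
Qed.

Let Kmul1l : left_id (Kclass Kone) Kproduct.
Proof. by elim/KclassW=> x; rewrite KmulE; apply/milnorK_eq; apply: Kc_mul1l. Qed.

Let Kmul1r : right_id (Kclass Kone) Kproduct.
Proof. by elim/KclassW=> x; rewrite KmulE; apply/milnorK_eq; apply: Kc_mul1r. Qed.

Let KmulDl : left_distributive Kproduct Kaddition.
Proof.
elim/KclassW=> x; elim/KclassW=> y; elim/KclassW=> z.
by rewrite !(KmulE, KaddE); apply/milnorK_eq; apply: Kc_mulDl.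
Qed.

Let KmulDr : right_distributive Kproduct Kaddition.
Proof.
elim/KclassW=> x; elim/KclassW=> y; elim/KclassW=> z.
by rewrite !(KmulE, KaddE); apply/milnorK_eq; apply: Kc_mulDr.
Qed.

HB.instance Definition _ :=
  GRing.Zmodule_isPzRing.Build milnorK KmulA Kmul1l Kmul1r KmulDl KmulDr.

Definition Ksymbol (a : nz k) : milnorK := Kclass (Ksym a).

Lemma KsymbolM (a b c : nz k) :
  val c = val a * val b -> Ksymbol c = Ksymbol a + Ksymbol b.
Proof.
move=> cab; rewrite /Ksymbol [RHS]KaddE.
by apply/milnorK_eq; apply: Kc_symM.
Qed.

Lemma Ksymbol_steinberg (a b : nz k) :
  val a + val b = 1 -> Ksymbol a * Ksymbol b = 0.
Proof.
move=> ab; rewrite /Ksymbol [LHS]KmulE.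
by apply/milnorK_eq; apply: Kc_steinberg.
Qed.

Section Lift.
Variables (R : pzRingType) (g : nz k -> R).
Hypothesis gM : forall a b c, val c = val a * val b -> g c = g a + g b.
Hypothesis gS : forall a b, val a + val b = 1 -> g a * g b = 0.

Fixpoint Keval (t : Kterm) : R :=
  match t with
  | Kzero => 0
  | Kone => 1
  | Ksym a => g a
  | Kopp x => - Keval x
  | Kadd x y => Keval x + Keval y
  | Kmul x y => Keval x * Keval y
  end.

Lemma Keval_cong t u : Kcong t u -> Keval t = Keval u.
Proof.
elim=> //=.
- by move=> x y z _ -> _ ->.
- by move=> x x' _ ->.
- by move=> x x' y y' _ -> _ ->.
- by move=> x x' y y' _ -> _ ->.
- by move=> x y z; rewrite addrA.
- by move=> x y; rewrite addrC.
- by move=> x; rewrite add0r.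
- by move=> x; rewrite addNr.
- by move=> x y z; rewrite mulrA.
- by move=> x; rewrite mul1r.
- by move=> x; rewrite mulr1.
- by move=> x y z; rewrite mulrDl.
- by move=> x y z; rewrite mulrDr.
Qed.

End Lift.

Definition Klift (R : pzRingType) (g : nz k -> R) (x : milnorK) : R :=
  Keval g (repr x).

Section LiftTheory.
Variables (R : pzRingType) (g : nz k -> R).
Hypothesis gM : forall a b c, val c = val a * val b -> g c = g a + g b.
Hypothesis gS : forall a b, val a + val b = 1 -> g a * g b = 0.

Lemma Klift_pi t : Klift g (Kclass t) = Keval g t.
Proof. by apply: Keval_cong => //; apply: milnorK_repr. Qed.

Lemma Klift_symbol a : Klift g (Ksymbol a) = g a.
Proof. exact: Klift_pi. Qed.

Lemma Klift_zmod_morphism : zmod_morphism (Klift g).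
Proof.
elim/KclassW=> x; elim/KclassW=> y.
have -> : Kclass x - Kclass y = Kclass (Kadd x (Kopp y)).
  by rewrite -[RHS]KaddE -KoppE.
by rewrite !Klift_pi.
Qed.

Lemma Klift_monoid_morphism : monoid_morphism (Klift g).
Proof.
split; first exact: (Klift_pi Kone).
elim/KclassW=> x; elim/KclassW=> y.
have -> : Kclass x * Kclass y = Kclass (Kmul x y).
  by rewrite -[RHS]KmulE.
by rewrite !Klift_pi.
Qed.

End LiftTheory.

Lemma milnorK_1neq0 : (1 : milnorK) != 0.
Proof.
pose g (_ : nz k) : int := 0.
have gM a b c : val c = val a * val b -> g c = g a + g b by [].
have gS a b : val a + val b = 1 -> g a * g b = 0 by [].
apply/eqP => /(congr1 (Klift g)).
by rewrite -[1]/(Kclass Kone) -[0]/(Kclass Kzero) !(Klift_pi gM gS).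
Qed.

HB.instance Definition _ :=
  GRing.PzSemiRing_isNonZero.Build milnorK milnorK_1neq0.
End MilnorRing.

Section Functoriality.
Variables (k k' : fieldType) (f : {rmorphism k -> k'}).

Definition nz_map (a : nz k) : nz k' :=
  exist _ (f (val a)) (etrans (congr1 negb (fmorph_eq0 f (val a))) (valP a)).

Definition Kmap : milnorK k -> milnorK k' :=
  Klift (fun a => Ksymbol (nz_map a)).

Let gM (a b c : nz k) : val c = val a * val b ->
  Ksymbol (nz_map c) = Ksymbol (nz_map a) + Ksymbol (nz_map b).
Proof. by move=> cab; apply: KsymbolM; rewrite /= cab rmorphM. Qed.

Let gS (a b : nz k) : val a + val b = 1 ->
  Ksymbol (nz_map a) * Ksymbol (nz_map b) = 0.
Proof.
by move=> ab; apply: Ksymbol_steinberg; rewrite /= -rmorphD ab rmorph1.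
Qed.

Lemma Kmap_symbol (a : nz k) : Kmap (Ksymbol a) = Ksymbol (nz_map a).
Proof. exact: Klift_symbol. Qed.

HB.instance Definition _ :=
  GRing.isZmodMorphism.Build _ _ Kmap (Klift_zmod_morphism gM gS).
HB.instance Definition _ :=
  GRing.isMonoidMorphism.Build _ _ Kmap (Klift_monoid_morphism gM gS).

End Functoriality.

Arguments Kzero {k}.
Arguments Kone {k}.

Lemma Kmap_comp (k0 k k' : fieldType) (j : {rmorphism k0 -> k})
    (f : {rmorphism k -> k'}) (j' : {rmorphism k0 -> k'}) :
  f \o j =1 j' -> forall a, Kmap j' a = Kmap f (Kmap j a).
Proof.
move=> fj; elim/KclassW; elim=> [||a|t IH|t IHt u IHu|t IHt u IHu].
- by rewrite -[Kclass Kzero]/(0 : milnorK k0) !raddf0.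
- by rewrite -[Kclass Kone]/(1 : milnorK k0) !rmorph1.
- rewrite -[Kclass (Ksym a)]/(Ksymbol a) !Kmap_symbol; congr Ksymbol.
  by apply: val_inj; rewrite /= -fj.
- by rewrite -KoppE -[Kopposite _]/(- Kclass t) !raddfN /= IH.
- by rewrite -KaddE -[Kaddition _ _]/(Kclass t + Kclass u) !raddfD /= IHt IHu.
- by rewrite -KmulE -[Kproduct _ _]/(Kclass t * Kclass u) !rmorphM /= IHt IHu.
Qed.

Section Degree.
Variables (k : fieldType) (i : nat).

(* The degree i part K_i(k) of K_*(k), as the additive subgroup generated by
   the products {a_1}...{a_i}; it is the image of Z for i = 0. *)
Definition Kdeg : {pred milnorK k} := fun x =>
  `[< exists s : seq (int * i.-tuple (nz k)),
        x = \sum_(p <- s) (\prod_(a <- p.2) Ksymbol a) *~ p.1 >].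

Lemma Kdeg_zmod_closed : zmod_closed Kdeg.
Proof.
split; first by apply/asboolP; exists [::]; rewrite big_nil.
move=> _ _ /asboolP[s ->] /asboolP[t ->]; apply/asboolP.
exists (s ++ [seq (- p.1, p.2) | p <- t]).
rewrite big_cat big_map /= -sumrN; congr (_ + _).
by apply: eq_bigr => p _; rewrite mulrNz.
Qed.

HB.instance Definition _ := GRing.isZmodClosed.Build _ Kdeg Kdeg_zmod_closed.

Record milnorKn := MilnorKn { Kn_val :> milnorK k; Kn_valP : Kn_val \in Kdeg }.

HB.instance Definition _ := [isSub for Kn_val].
HB.instance Definition _ := [Choice of milnorKn by <:].
HB.instance Definition _ := [SubChoice_isSubZmodule of milnorKn by <:].

End Degree.

Arguments Kdeg k i x : clear implicits.

Lemma Kmap_deg (k k' : fieldType) (f : {rmorphism k -> k'}) (i : nat)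
  (x : milnorKn k i) : Kmap f x \in Kdeg k' i.
Proof.
case: x => _ /= /asboolP[s ->]; apply/asboolP.
exists [seq (p.1, map_tuple (nz_map f) p.2) | p <- s].
rewrite big_map raddf_sum /=; apply: eq_bigr => p _.
rewrite raddfMz /= rmorph_prod big_map; congr (_ *~ _).
by apply: eq_bigr => a _; rewrite /= Kmap_symbol.
Qed.

Definition Knmap (k k' : fieldType) (f : {rmorphism k -> k'}) (i : nat)
  (x : milnorKn k i) : milnorKn k' i := MilnorKn (Kmap_deg f x).

Section Operations.
Variables (k0 : fieldType) (i : nat).

(* A field extension k/k0 is a field k with a ring morphism j : k0 -> k, and a
   morphism of extensions is a ring morphism commuting with these. *)
Record operation := Operation {
  op_fun :> forall (k : fieldType) (j : {rmorphism k0 -> k}),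
    milnorKn k i -> milnorK k;
  op_natural : forall (k k' : fieldType)
      (j : {rmorphism k0 -> k}) (j' : {rmorphism k0 -> k'})
      (f : {rmorphism k -> k'}), f \o j =1 j' ->
    forall x : milnorKn k i, op_fun j' (Knmap f x) = Kmap f (op_fun j x)
}.

Definition op_is_additive (phi : operation) : Prop :=
  forall (k : fieldType) (j : {rmorphism k0 -> k}) (x y : milnorKn k i),
    phi k j (x + y) = phi k j x + phi k j y.

Lemma op_id_natural (k k' : fieldType)
    (j : {rmorphism k0 -> k}) (j' : {rmorphism k0 -> k'})
    (f : {rmorphism k -> k'}) : f \o j =1 j' ->
  forall x : milnorKn k i, Kn_val (Knmap f x) = Kmap f (Kn_val x).
Proof. by []. Qed.

(* The identity map, that is, the inclusion of K_i in K_*. *)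
Definition op_id : operation :=
  @Operation (fun k _ x => Kn_val x) op_id_natural.

Section Scale.
Variables (a : milnorK k0) (phi : operation).

Lemma op_scale_natural (k k' : fieldType)
    (j : {rmorphism k0 -> k}) (j' : {rmorphism k0 -> k'})
    (f : {rmorphism k -> k'}) : f \o j =1 j' ->
  forall x : milnorKn k i,
    Kmap j' a * phi k' j' (Knmap f x) = Kmap f (Kmap j a * phi k j x).
Proof.
by move=> fj x; rewrite rmorphM /= (op_natural phi fj) (Kmap_comp fj).
Qed.

Definition op_scale : operation :=
  @Operation (fun k j x => Kmap j a * phi k j x) op_scale_natural.

End Scale.
End Operations.

(* Main.v *)
Require Import Defs.
From HB Require Import structures.
From mathcomp Require Import all_boot all_order all_algebra.
Import GRing.Theory.
Local Open Scope ring_scope.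

(** An additive operation is determined by its values on products of symbols,
    where it becomes a natural family of multiadditive maps
    [(k^* )^i -> K_*(k)].  Such families are treated one variable at a time, so
    everything rests on the case of a natural additive map
    [phi : k^* -> K_*(k)] over a base field [k0], and on the field of rational
    functions [k0(t)] with its valuation at infinity.

    A symbol on [k] with values in a ring [R], together with a value [e] for the
    variable, extends to [k(t)] by
    [p / q |-> {lead p} - {lead q} + (deg p - deg q) e]
    provided that [e] behaves like a symbol, that is, anticommutes with the
    symbols and satisfies [e^2 = {-1} e] ([frac_steinberg]).  Taking [e = 0]
    gives the specialization [K_*(k(t)) -> K_*(k)], a retraction of the map
    induced by [k -> k(t)].  Taking for [e] a formal variable gives the
    specialization [a0] and the residue [a1] of an element at once, as its image
    [a0 + a1 e].  It follows that a ring morphism which on symbols depends only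
    on leading coefficients and degrees sends every [x] to
    [specialization + residue * (value of t)] ([residue_expansion]).

    Put [a = phi({t})] in [K_*(k0(t))].  For [u] in [k^*], naturality gives
    [phi({us}) = a(us)] and [phi({s}) = a(s)] in [K_*(k(s))], where [a(us)]
    and [a(s)] are the images of [a] under [t |-> us] and [t |-> s].  Hence
    [phi({u}) = a(us) - a(s)].  The specialization at infinity of the right hand
    side only sees the leading coefficients and degrees of the functions which
    occur in [a]: it is [(a0 + a1 {u}) - (a0 + a1 {1}) = a1 {u}].  So [phi] is
    multiplication by the residue [a1] of [phi({t})] ([additive_on_units]).

    The residue also recovers [a] from [a {t}], which gives the uniqueness of
    the coefficient.  In the induction on the number of variables, it shows that
    the coefficient obtained by freezing all variables but the last is again
    natural and multiadditive in the frozen ones ([multiadditive_natural]). *)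

Set Implicit Arguments.
Unset Strict Implicit.
Unset Printing Implicit Defensive.

(** * Symbols with values in a ring *)

Section SteinbergSymbols.
Variables (F : fieldType) (R : pzRingType).

(** A symbol is a total function on [F], constrained on nonzero elements only:
    this avoids carrying proofs of invertibility through products and quotients. *)
Record steinberg := Steinberg {
  steinberg_fun :> F -> R;
  steinbergM : forall a b, a != 0 -> b != 0 ->
    steinberg_fun (a * b) = steinberg_fun a + steinberg_fun b;
  steinberg_add1 : forall a b, a != 0 -> b != 0 -> a + b = 1 ->
    steinberg_fun a * steinberg_fun b = 0
}.

Variable s : steinberg.

Definition Kext : milnorK F -> R := Klift (fun u => s (val u)).

Let gM (a b c : nz F) : val c = val a * val b ->
  s (val c) = s (val a) + s (val b).
Proof. by move=> ->; exact: steinbergM (valP a) (valP b). Qed.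

Let gS (a b : nz F) : val a + val b = 1 -> s (val a) * s (val b) = 0.
Proof. exact: steinberg_add1 (valP a) (valP b). Qed.

Lemma Kext_symbol u : Kext (Ksymbol u) = s (val u).
Proof. exact: Klift_symbol. Qed.

HB.instance Definition _ :=
  GRing.isZmodMorphism.Build _ _ Kext (Klift_zmod_morphism gM gS).
HB.instance Definition _ :=
  GRing.isMonoidMorphism.Build _ _ Kext (Klift_monoid_morphism gM gS).

Lemma steinberg1 : s 1 = 0.
Proof.
have := steinbergM s (oner_neq0 F) (oner_neq0 F); rewrite mulr1 => /eqP.
by rewrite -subr_eq0 opprD addNKr oppr_eq0 => /eqP.
Qed.

Lemma steinbergV a : a != 0 -> s a^-1 = - s a.
Proof.
move=> a0; apply/eqP; rewrite -addr_eq0 -steinbergM ?invr_eq0 //.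
by rewrite mulVf // steinberg1.
Qed.

Lemma steinberg_div a b : a != 0 -> b != 0 -> s (a / b) = s a - s b.
Proof. by move=> a0 b0; rewrite steinbergM ?invr_eq0 ?steinbergV. Qed.

Lemma steinbergN a : a != 0 -> s (- a) = s (- 1) + s a.
Proof. by move=> a0; rewrite -steinbergM ?oppr_eq0 ?oner_eq0 ?mulN1r. Qed.

Lemma steinbergN1D : s (- 1) + s (- 1) = 0.
Proof. by rewrite -steinbergN ?oppr_eq0 ?oner_eq0 // opprK steinberg1. Qed.

Lemma steinbergN1N : - s (- 1) = s (- 1).
Proof. by apply/eqP; rewrite eq_sym -addr_eq0 steinbergN1D. Qed.

(** When a is not 1, [- a = (1 - a) / (1 - a^-1)]. *)
Lemma steinberg_mulN a : a != 0 -> s a * s (- a) = 0.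
Proof.
move=> a0; have [->|a1] := eqVneq a 1; first by rewrite steinberg1 mul0r.
have b0 : 1 - a != 0 by rewrite subr_eq0 eq_sym.
have c0 : 1 - a^-1 != 0 by rewrite subr_eq0 eq_sym invr_eq1.
have -> : - a = (1 - a) / (1 - a^-1).
  by apply: (canRL (mulfK c0)); rewrite mulrBr mulr1 mulNr divff // opprK addrC.
have subKx (x : F) : x + (1 - x) = 1 by rewrite addrC subrK.
have ab : s a * s (1 - a) = 0 by apply: steinberg_add1.
have ac : s a * s (1 - a^-1) = 0.
  rewrite -[s a]opprK -steinbergV // mulNr steinberg_add1 ?oppr0 //.
  by rewrite invr_eq0.
by rewrite steinberg_div // mulrBr ab ac subrr.
Qed.

(** This is [{a}{-a} = 0] with [- a] in place of [a]. *)
Lemma steinberg_sqr a : a != 0 -> s a * s a = s (- 1) * s a.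
Proof.
move=> a0; have n0 : - a != 0 by rewrite oppr_eq0.
have := steinberg_mulN n0; rewrite opprK steinbergN // mulrDl => /eqP.
by rewrite addrC addr_eq0 -mulNr steinbergN1N => /eqP.
Qed.

(** Expand [{ab}{ab} = {-1}{ab}]. *)
Lemma steinberg_anticomm a b : a != 0 -> b != 0 -> s a * s b = - (s b * s a).
Proof.
move=> a0 b0; apply/eqP; rewrite -addr_eq0.
have ab0 : a * b != 0 by rewrite mulf_neq0.
have := steinberg_sqr ab0; rewrite steinbergM // mulrDr.
rewrite !mulrDl !steinberg_sqr // mulrDr.
rewrite -addrA => /addrI; rewrite addrA -[RHS]add0r => /addIr <-.
by rewrite addrC.
Qed.

End SteinbergSymbols.

(** * Numerators and denominators *)

Section FractionField.
Variable A : idomainType.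
Local Notation "p %:F" := (FracField.tofrac p).

Definition fnum (x : {fraction A}) : A := (frac (repr x)).1.
Definition fden (x : {fraction A}) : A := (frac (repr x)).2.

Lemma fden_neq0 x : fden x != 0.
Proof. exact: denom_ratioP. Qed.

Lemma fractionE (x : {fraction A}) : x = (fnum x)%:F / (fden x)%:F.
Proof.
have d0 := fden_neq0 x.
apply: (canRL (mulfK _)); first by rewrite tofrac_eq0.
rewrite -[X in X * _](reprK x); unlock FracField.tofrac.
rewrite -[LHS]FracField.pi_mul; apply/eqmodP => /=.
rewrite FracField.equivfE /FracField.mulf /= !numden_Ratio ?oner_neq0 ?mulr1 //.
by rewrite mulrC.
Qed.

Lemma fnum_neq0 x : x != 0 -> fnum x != 0.
Proof.
by apply: contraNneq => n0; rewrite [x]fractionE n0 rmorph0 mul0r.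
Qed.

Lemma fraction_scale (n d e : A) : e != 0 ->
  (n * e)%:F / (d * e)%:F = n%:F / d%:F.
Proof.
move=> e0; have te0 : e%:F != 0 by rewrite tofrac_eq0.
have MF a b : (a * b)%:F = a%:F * b%:F by apply: rmorphM.
by rewrite !MF -[LHS](mulf_div n%:F d%:F e%:F e%:F) (divff te0) mulr1.
Qed.

Lemma fnum_cross n d : d != 0 ->
  fnum (n%:F / d%:F) * d = n * fden (n%:F / d%:F).
Proof.
move=> d0; apply/eqP; rewrite -tofrac_eq !rmorphM /=.
have := fractionE (n%:F / d%:F).
set e := fden _; move=> /eqP; rewrite eqr_div ?tofrac_eq0 ?fden_neq0 //.
by move=> /eqP ->; rewrite mulrC.
Qed.

End FractionField.

(** * The symbol at infinity on a rational function field *)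

Section ValueAtInfinity.
Variables (k : fieldType) (R : pzRingType) (s : steinberg k R) (e : R).
Hypothesis e_anti : forall c : k, c != 0 -> e * s c = - (s c * e).
Hypothesis e_sqr : e * e = s (- 1) * e.

(** The value of a polynomial is that of its leading term, where [e] is the
    value of the variable. *)
Definition poly_sym (p : {poly k}) : R := s (lead_coef p) + e *+ (size p).-1.

Lemma poly_symM p q : p != 0 -> q != 0 ->
  poly_sym (p * q) = poly_sym p + poly_sym q.
Proof.
move=> p0 q0; rewrite /poly_sym lead_coefM steinbergM ?lead_coef_eq0 //.
rewrite addrACA -mulrnDr size_mul //; congr (_ + _ *+ _).
rewrite -[size p]prednK ?size_poly_gt0 // -[size q]prednK ?size_poly_gt0 //.
by rewrite addnS.
Qed.

Lemma affine_anti c d : c != 0 ->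
  (s c + e *+ d) * s (- 1) = - (s (- 1) * (s c + e *+ d)).
Proof.
move=> c0; have m0 : (- 1 : k) != 0 by rewrite oppr_eq0 oner_neq0.
rewrite mulrDl mulrDr opprD steinberg_anticomm //; congr (_ + _).
by rewrite mulrnAl e_anti // mulrnAr mulNrn.
Qed.

(** The cross terms cancel by anticommutativity, and the two sides then differ
    by [d (d - 1)] times the 2-torsion element [s (- 1) * e]. *)
Lemma affine_sqr c d : c != 0 ->
  (s c + e *+ d) * (s c + e *+ d) = s (- 1) * (s c + e *+ d).
Proof.
move=> c0; rewrite mulrDl !mulrDr steinberg_sqr // -addrA; congr (_ + _).
rewrite mulrnAl e_anti // mulrnAr addrA mulNrn subrr add0r.
rewrite mulrnAl !mulrnAr e_sqr -mulrnA.
have N1e2 : s (- 1) * e *+ 2 = 0 by rewrite mulr2n -mulrDl steinbergN1D mul0r.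
case: d => // d; rewrite mulnS mulrnDr -[RHS]addr0; congr (_ + _).
have /dvdnP[m ->] : (2 %| d.+1 * d)%N by rewrite dvdn2 oddM /= andNb.
by rewrite mulnC mulrnA N1e2 mul0rn.
Qed.

Lemma poly_sym_opp p : p != 0 -> poly_sym (- p) = s (- 1) + poly_sym p.
Proof.
move=> p0; rewrite /poly_sym lead_coefN size_polyN.
by rewrite steinbergN ?lead_coef_eq0 // addrA.
Qed.

(** Among the degrees of [p], [q] and their sum [r], the largest is attained at
    least twice.  If [r] and only one summand have this degree, they have the same leading term
    and one of the two factors vanishes.  If only [p] and [q] have it, their
    leading terms are opposite and the relation [{a}{-a} = 0] applies.  If all
    three have it, the leading coefficients add up, and this is the Steinberg
    relation in [k]. *)
Lemma poly_sym_steinberg (p q r : {poly k}) :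
  p != 0 -> q != 0 -> r != 0 -> p + q = r ->
  (poly_sym p - poly_sym r) * (poly_sym q - poly_sym r) = 0.
Proof.
have dom (p' q' : {poly k}) : (size p' < size q')%N ->
    poly_sym (p' + q') = poly_sym q'.
  by move=> pq; rewrite [p' + q']addrC /poly_sym lead_coefDl // size_polyDl.
move=> p0 q0 r0 pqr; have [pr|rp] := ltnP (size p) (size r).
  have -> : q = - p + r by rewrite -pqr addKr.
  by rewrite dom ?size_polyN // subrr mulr0.
have [qr|rq] := ltnP (size q) (size r).
  have -> : p = - q + r by rewrite -pqr addrC addrK.
  by rewrite dom ?size_polyN // subrr mul0r.
have lp0 : lead_coef p != 0 by rewrite lead_coef_eq0.
have lq0 : lead_coef q != 0 by rewrite lead_coef_eq0.
have lr0 : lead_coef r != 0 by rewrite lead_coef_eq0.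
have [rltp|prle] := ltnP (size r) (size p).
  have qE : poly_sym q = s (- 1) + poly_sym p.
    have -> : q = r + - p by rewrite -pqr addrC addKr.
    by rewrite dom ?size_polyN // poly_sym_opp.
  have -> : poly_sym q - poly_sym r = poly_sym p - poly_sym r + s (- 1).
    by rewrite qE -addrA addrC.
  set c := lead_coef p / lead_coef r.
  have c0 : c != 0 by rewrite mulf_neq0 ?invr_eq0.
  have -> : poly_sym p - poly_sym r =
      s c + e *+ ((size p).-1 - (size r).-1).
    rewrite /c steinberg_div // /poly_sym mulrnBr ?opprD; last first.
      by rewrite -!subn1 leq_sub2r.
    by rewrite addrACA.
  by rewrite mulrDr affine_sqr // affine_anti // subrr.
have sp : size p = size r by apply/eqP; rewrite eqn_leq prle.
have sq : size q = size r.
  apply/eqP; rewrite eqn_leq rq andbT.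
  have -> : q = r + - p by rewrite -pqr addrC addKr.
  by rewrite (leq_trans (size_polyD _ _)) // size_polyN sp maxnn.
have lrE : lead_coef p + lead_coef q = lead_coef r.
  by rewrite !lead_coefE sp sq -coefD pqr.
rewrite /poly_sym sp sq !opprD ![_ + _ + (- _ - _)]addrACA !subrr !addr0.
rewrite -!steinberg_div // steinberg_add1 ?mulf_neq0 ?invr_eq0 //.
by rewrite -mulrDl lrE divff.
Qed.

Definition frac_sym (x : {fraction {poly k}}) : R :=
  poly_sym (fnum x) - poly_sym (fden x).

Lemma frac_sym_div p q : p != 0 -> q != 0 ->
  frac_sym (FracField.tofrac p / FracField.tofrac q)
    = poly_sym p - poly_sym q.
Proof.
move=> p0 q0; rewrite /frac_sym; set x := _ / _.
have x0 : x != 0 by rewrite mulf_neq0 ?invr_eq0 ?tofrac_eq0.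
have d0 := fden_neq0 x; have n0 := fnum_neq0 x0.
apply/eqP; rewrite subr_eq addrAC eq_sym subr_eq; apply/eqP.
by rewrite -!poly_symM // fnum_cross.
Qed.

Lemma frac_symM x y : x != 0 -> y != 0 ->
  frac_sym (x * y) = frac_sym x + frac_sym y.
Proof.
move=> x0 y0; rewrite [in LHS](fractionE x) [in LHS](fractionE y).
have [dx dy] := (fden_neq0 x, fden_neq0 y).
have [nx ny] := (fnum_neq0 x0, fnum_neq0 y0).
rewrite mulf_div -!rmorphM frac_sym_div ?mulf_neq0 // !poly_symM //.
by rewrite opprD addrACA.
Qed.

Lemma frac_sym_steinberg x y : x != 0 -> y != 0 -> x + y = 1 ->
  frac_sym x * frac_sym y = 0.
Proof.
move=> x0 y0; have [dx dy] := (fden_neq0 x, fden_neq0 y).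
have [nx ny] := (fnum_neq0 x0, fnum_neq0 y0).
set r := fden x * fden y; have r0 : r != 0 by rewrite mulf_neq0.
have tr0 : FracField.tofrac r != 0 by rewrite tofrac_eq0.
have xE : x = FracField.tofrac (fnum x * fden y) / FracField.tofrac r.
  by rewrite {1}[x]fractionE -(fraction_scale _ _ dy).
have yE : y = FracField.tofrac (fnum y * fden x) / FracField.tofrac r.
  by rewrite {1}[y]fractionE -(fraction_scale _ _ dx) /r [fden x * _]mulrC.
move=> xy1; have : FracField.tofrac (fnum x * fden y) / FracField.tofrac r +
    FracField.tofrac (fnum y * fden x) / FracField.tofrac r = 1.
  by rewrite -xE -yE.
rewrite -mulrDl => /(canRL (mulfVK tr0)); rewrite mul1r -rmorphD.
move/eqP; rewrite tofrac_eq => /eqP pqr.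
have -> : frac_sym x = poly_sym (fnum x * fden y) - poly_sym r.
  by rewrite {1}xE frac_sym_div // mulf_neq0.
have -> : frac_sym y = poly_sym (fnum y * fden x) - poly_sym r.
  by rewrite {1}yE frac_sym_div // mulf_neq0.
by apply: poly_sym_steinberg pqr; rewrite ?mulf_neq0.
Qed.

Definition frac_steinberg : steinberg {fraction {poly k}} R :=
  Steinberg frac_symM frac_sym_steinberg.

End ValueAtInfinity.

Section ValueOfConstants.
Variables (k : fieldType) (R : pzRingType) (s : steinberg k R) (e : R).
Local Notation tofrac := (@FracField.tofrac {poly k}).

Lemma frac_sym_tofrac p : p != 0 -> frac_sym s e (tofrac p) = poly_sym s e p.
Proof.
move=> p0; rewrite -[tofrac p]divr1 -(rmorph1 tofrac).
rewrite frac_sym_div ?oner_neq0 //.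
by rewrite {2}/poly_sym lead_coef1 size_poly1 steinberg1 addr0 subr0.
Qed.

Lemma frac_symC c : c != 0 -> frac_sym s e (tofrac c%:P) = s c.
Proof.
move=> c0; rewrite frac_sym_tofrac ?polyC_eq0 //.
by rewrite /poly_sym lead_coefC size_polyC c0 addr0.
Qed.

Lemma frac_symX : frac_sym s e (tofrac 'X) = e.
Proof.
rewrite frac_sym_tofrac ?polyX_eq0 // /poly_sym lead_coefX size_polyX.
by rewrite steinberg1 add0r.
Qed.

End ValueOfConstants.

(** * The universal symbol *)

Section Milnor.
Variable k : fieldType.

Lemma milnorK_ind (P : milnorK k -> Prop) :
  P 0 -> P 1 -> (forall u, P (Ksymbol u)) ->
  (forall x, P x -> P (- x)) ->
  (forall x y, P x -> P y -> P (x + y)) ->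
  (forall x y, P x -> P y -> P (x * y)) -> forall x, P x.
Proof.
move=> P0 P1 Ps PN PD PM; elim/KclassW.
elim=> [||u|t IH|t IHt u IHu|t IHt u IHu].
- exact: P0.
- exact: P1.
- exact: Ps.
- by rewrite -KoppE; apply: PN.
- by rewrite -KaddE; apply: PD.
- by rewrite -KmulE; apply: PM.
Qed.

Definition symb (a : k) : milnorK k := oapp (@Ksymbol k) 0 (insub a).

Lemma symb_val (u : nz k) : symb (val u) = Ksymbol u.
Proof. by rewrite /symb valK. Qed.

Lemma symbM a b : a != 0 -> b != 0 -> symb (a * b) = symb a + symb b.
Proof.
move=> a0 b0; have ab0 : a * b != 0 by rewrite mulf_neq0.
pose ua : nz k := exist _ a a0; pose ub : nz k := exist _ b b0.
pose uab : nz k := exist _ (a * b) ab0.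
rewrite -[a]/(val ua) -[b]/(val ub) -[val ua * _]/(val uab) !symb_val.
exact: KsymbolM.
Qed.

Lemma symb_add1 a b : a != 0 -> b != 0 -> a + b = 1 -> symb a * symb b = 0.
Proof.
move=> a0 b0.
pose ua : nz k := exist _ a a0; pose ub : nz k := exist _ b b0.
rewrite -[a]/(val ua) -[b]/(val ub) !symb_val.
exact: Ksymbol_steinberg.
Qed.

Definition milnor_steinberg : steinberg k (milnorK k) :=
  Steinberg symbM symb_add1.

End Milnor.

Section PostComposition.
Variables (k : fieldType) (R R' : pzRingType) (h : {rmorphism R -> R'}).
Variable s : steinberg k R.

Let compM a b : a != 0 -> b != 0 -> h (s (a * b)) = h (s a) + h (s b).
Proof. by move=> a0 b0; rewrite steinbergM // rmorphD. Qed.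

Let comp_add1 a b : a != 0 -> b != 0 -> a + b = 1 -> h (s a) * h (s b) = 0.
Proof. by move=> a0 b0 ab; rewrite -rmorphM steinberg_add1 // rmorph0. Qed.

Definition steinberg_comp : steinberg k R' := Steinberg compM comp_add1.

End PostComposition.

(** * Specialization and residue at infinity *)

Section FunctionField.
Variable k : fieldType.
Local Notation kt := {fraction {poly k}}.
Local Notation "{@ a }" := (milnor_steinberg k a) (format "{@ a }").

Definition fracC : {rmorphism k -> kt} := @FracField.tofrac {poly k} \o polyC.

Lemma fracX_neq0 : @FracField.tofrac {poly k} 'X != 0.
Proof. by rewrite tofrac_eq0 polyX_eq0. Qed.

Definition fracX : nz kt :=
  exist (fun x => x != 0) _ fracX_neq0.

Let anti0 (c : k) : c != 0 -> 0 * {@c} = - ({@c} * 0).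
Proof. by rewrite mul0r mulr0 oppr0. Qed.

Let sqr0 : 0 * 0 = {@- 1} * 0.
Proof. by rewrite !mulr0. Qed.

Definition specialize : milnorK kt -> milnorK k :=
  Kext (frac_steinberg anti0 sqr0).
HB.instance Definition _ := GRing.RMorphism.on specialize.

Lemma specialize_symbol u :
  specialize (Ksymbol u) = frac_sym (milnor_steinberg k) 0 (val u).
Proof. by rewrite /specialize Kext_symbol. Qed.

Lemma specialize_fracC x : specialize (Kmap fracC x) = x.
Proof.
elim/milnorK_ind: x => [||u|x IHx|x y IHx IHy|x y IHx IHy].
- by rewrite !rmorph0.
- by rewrite !rmorph1.
- rewrite Kmap_symbol specialize_symbol [LHS]frac_symC ?(valP u) //.
  exact: symb_val.
- by rewrite !rmorphN /= IHx.
- by rewrite !rmorphD /= IHx IHy.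
- by rewrite !rmorphM /= IHx IHy.
Qed.

(** The extension of [K_*(k)] by a variable [e] with [e {c} = - {c} e] and
    [e^2 = {-1} e] has the left basis [1, e].  It is realized as the ring of
    matrices of its right multiplications: those of [{c}] and [e] have the rows
    [({c}, 0), (0, - {c})] and [(0, 1), (0, {-1})]. *)
Definition tri (x y z : milnorK k) : 'M[milnorK k]_2 :=
  \matrix_(i, j) (if i == 0 then if j == 0 then x else y
                  else if j == 0 then 0 else z).

Lemma triD x y z x' y' z' :
  tri x y z + tri x' y' z' = tri (x + x') (y + y') (z + z').
Proof.
apply/matrixP => i j; rewrite !mxE.
by case: (i == 0); case: (j == 0); rewrite ?addr0.
Qed.

Lemma triN x y z : - tri x y z = tri (- x) (- y) (- z).
Proof.
apply/matrixP => i j; rewrite !mxE.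
by case: (i == 0); case: (j == 0); rewrite ?oppr0.
Qed.

Lemma triM x y z x' y' z' :
  tri x y z * tri x' y' z' = tri (x * x') (x * y' + y * z') (z * z').
Proof.
apply/matrixP => i j; rewrite !mxE !big_ord_recl big_ord0 !mxE /= addr0.
by case: (i == 0); case: (j == 0); rewrite ?mulr0 ?mul0r ?addr0 ?add0r.
Qed.

Lemma tri0 : tri 0 0 0 = 0.
Proof. by apply/matrixP => i j; rewrite !mxE; do 2!case: ifP. Qed.

Lemma tri1 : tri 1 0 1 = 1.
Proof.
apply/matrixP => i j; rewrite !mxE.
by case: i j => [[|[|?]] ?] [[|[|?]] ?].
Qed.

Let diag_symM a b : a != 0 -> b != 0 ->
  tri {@a * b} 0 (- {@a * b}) = tri {@a} 0 (- {@a}) + tri {@b} 0 (- {@b}).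
Proof. by move=> a0 b0; rewrite triD steinbergM // opprD addr0. Qed.

Let diag_sym_add1 a b : a != 0 -> b != 0 -> a + b = 1 ->
  tri {@a} 0 (- {@a}) * tri {@b} 0 (- {@b}) = 0.
Proof.
move=> a0 b0 ab; rewrite triM mulrNN steinberg_add1 //.
by rewrite mulr0 mul0r addr0 tri0.
Qed.

Definition diag_steinberg : steinberg k 'M[milnorK k]_2 :=
  Steinberg diag_symM diag_sym_add1.

Definition tri_eps := tri 0 1 {@- 1}.

Let N1_neq0 : (- 1 : k) != 0.
Proof. by rewrite oppr_eq0 oner_neq0. Qed.

Lemma tri_eps_anti (c : k) : c != 0 ->
  tri_eps * diag_steinberg c = - (diag_steinberg c * tri_eps).
Proof.
move=> c0; rewrite /diag_steinberg /= !triM triN !mul0r !mulr0 !mul1r !mulr1.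
rewrite add0r addr0 oppr0 mulrN mulNr opprK.
by rewrite -[symb c]/{@c} steinberg_anticomm ?opprK.
Qed.

Lemma tri_eps_sqr : tri_eps * tri_eps = diag_steinberg (- 1) * tri_eps.
Proof.
rewrite /diag_steinberg /= !triM !mul0r !mulr0 !mul1r !mulr1 add0r addr0.
by rewrite -[symb (- 1)]/{@- 1} steinbergN1N.
Qed.

(** The first row of [total_residue x] consists of the specialization of [x] and
    of its residue, its coordinates in the basis [1, e]. *)
Definition total_residue : milnorK kt -> 'M[milnorK k]_2 :=
  Kext (frac_steinberg tri_eps_anti tri_eps_sqr).
HB.instance Definition _ := GRing.RMorphism.on total_residue.

Lemma total_residue_symbol u :
  total_residue (Ksymbol u) = frac_sym diag_steinberg tri_eps (val u).
Proof. by rewrite /total_residue Kext_symbol. Qed.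

Lemma total_residue_fracC x :
  exists z, total_residue (Kmap fracC x) = tri x 0 z.
Proof.
elim/milnorK_ind: x
  => [||u|x [z IHx]|x y [z IHx] [z' IHy]|x y [z IHx] [z' IHy]].
- by exists 0; rewrite !rmorph0 tri0.
- by exists 1; rewrite !rmorph1 tri1.
- exists (- Ksymbol u); rewrite Kmap_symbol total_residue_symbol.
  by rewrite [LHS]frac_symC ?(valP u) // -symb_val.
- by exists (- z); rewrite !rmorphN /= IHx triN oppr0.
- by exists (z + z'); rewrite !rmorphD /= IHx IHy triD addr0.
- by exists (z * z'); rewrite !rmorphM /= IHx IHy triM mulr0 mul0r addr0.
Qed.

Definition residue (x : milnorK kt) : milnorK k := total_residue x 0 1.

Lemma residueD x y : residue (x + y) = residue x + residue y.
Proof. by rewrite /residue rmorphD mxE. Qed.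

Lemma residue_fracCX x : residue (Kmap fracC x * Ksymbol fracX) = x.
Proof.
rewrite /residue rmorphM /=; have [z ->] := total_residue_fracC x.
by rewrite total_residue_symbol /= frac_symX triM mxE /= mulr1 mul0r addr0.
Qed.

Section Expansion.
Variables (R : pzRingType) (h : {rmorphism milnorK k -> R}) (e : R).
Variable T : {rmorphism milnorK kt -> R}.
Hypothesis e_anti : forall c : k, c != 0 -> e * h {@c} = - (h {@c} * e).
Hypothesis e_sqr : e * e = h {@- 1} * e.
Hypothesis TE : forall u, T (Ksymbol u) =
  frac_sym (steinberg_comp h (milnor_steinberg k)) e (val u).

(* The row [(x, y)] stands for [x + y e].  Each [total_residue x] acts on rows
   as [T x] acts on [R] by right multiplication, because this holds for the
   symbols of constants and for the variable. *)
Let v (w : 'rV[milnorK k]_2) : R := h (w 0 0) + h (w 0 1) * e.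

Let vB w w' : v (w - w') = v w - v w'.
Proof. by rewrite /v !mxE !rmorphB mulrBl opprD addrACA. Qed.
Let vD w w' : v (w + w') = v w + v w'.
Proof. by rewrite /v !mxE !rmorphD mulrDl addrACA. Qed.

Let acts_as (A : 'M[milnorK k]_2) (b : R) := forall w, v (w *m A) = v w * b.

Let acts_asB A b A' b' : acts_as A b -> acts_as A' b' ->
  acts_as (A - A') (b - b').
Proof. by move=> Ab Ab' w; rewrite mulmxBr vB Ab Ab' mulrBr. Qed.

Let acts_asD A b A' b' : acts_as A b -> acts_as A' b' ->
  acts_as (A + A') (b + b').
Proof. by move=> Ab Ab' w; rewrite mulmxDr vD Ab Ab' mulrDr. Qed.

Let acts_asM A b A' b' : acts_as A b -> acts_as A' b' ->
  acts_as (A * A') (b * b').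
Proof. by move=> Ab Ab' w; rewrite -mulmxE mulmxA Ab' Ab mulrA. Qed.

Let acts_as0 : acts_as 0 0.
Proof. by move=> w; rewrite mulmx0 mulr0 /v !mxE !rmorph0 mul0r addr0. Qed.

Let acts_as1 : acts_as 1 1.
Proof. by move=> w; rewrite mulmx1 mulr1. Qed.

Let acts_asMn A b n : acts_as A b -> acts_as (A *+ n) (b *+ n).
Proof.
move=> Ab; elim: n => [|n IH]; first by rewrite !mulr0n.
by rewrite !mulrS; apply: acts_asD.
Qed.

Let w_tri x y z (w : 'rV[milnorK k]_2) :
  v (w *m tri x y z) = h (w 0 0 * x) + h (w 0 0 * y + w 0 1 * z) * e.
Proof.
have lift1 : lift ord0 ord0 = 1 :> 'I_2 by apply: val_inj.
by rewrite /v !mxE !big_ord_recl !big_ord0 !mxE /= !addr0 mulr0 addr0 lift1.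
Qed.

Let acts_as_diag c : c != 0 -> acts_as (diag_steinberg c) (h {@c}).
Proof.
move=> c0 w; rewrite w_tri /v mulr0 add0r mulrN rmorphN !rmorphM /= mulrDl.
by congr (_ + _); rewrite -mulrA e_anti // mulNr mulrN mulrA.
Qed.

Let acts_as_eps : acts_as tri_eps e.
Proof.
move=> w; rewrite w_tri /v mulr0 rmorph0 add0r mulr1.
rewrite !rmorphD rmorphM /= !mulrDl.
by rewrite -!mulrA e_sqr.
Qed.

Let acts_as_poly p : p != 0 -> acts_as (poly_sym diag_steinberg tri_eps p)
  (poly_sym (steinberg_comp h (milnor_steinberg k)) e p).
Proof.
move=> p0; apply: acts_asD; last exact: acts_asMn.
by apply: acts_as_diag; rewrite lead_coef_eq0.
Qed.

(** The universal case of a morphism that only depends on leading terms is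
    [total_residue]; the others are obtained from it by sending the formal
    variable to [e]. *)
Lemma residue_expansion x :
  T x = h (total_residue x 0 0) + h (residue x) * e.
Proof.
have acts : acts_as (total_residue x) (T x).
  elim/milnorK_ind: x => [||u|x IHx|x y IHx IHy|x y IHx IHy].
  - by rewrite !rmorph0.
  - by rewrite !rmorph1.
  - rewrite total_residue_symbol TE.
    apply: acts_asB; apply: acts_as_poly; last exact: fden_neq0.
    exact: fnum_neq0 (valP u).
  - rewrite !rmorphN /= -[- T x]add0r -[- total_residue x]add0r.
    exact: acts_asB.
  - by rewrite !rmorphD /=; apply: acts_asD.
  - by rewrite !rmorphM /=; apply: acts_asM.
have := acts (delta_mx 0 0); rewrite -rowE /v !mxE /=.
by rewrite rmorph1 rmorph0 mul0r addr0 mul1r.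
Qed.

End Expansion.
End FunctionField.

(** * Substitution of a multiple of the variable *)

Section FractionExtension.
Variables (A : idomainType) (L : fieldType) (f : {rmorphism A -> L}).
Hypothesis f_inj : forall a, a != 0 -> f a != 0.
Local Notation tofrac := (@FracField.tofrac A).

Definition frac_ext (x : {fraction A}) : L := f (fnum x) / f (fden x).

Lemma frac_ext_div n d : d != 0 -> frac_ext (tofrac n / tofrac d) = f n / f d.
Proof.
move=> d0; apply/eqP; rewrite eqr_div ?f_inj ?fden_neq0 //.
by rewrite -!rmorphM fnum_cross.
Qed.

Lemma frac_ext_tofrac n : frac_ext (tofrac n) = f n.
Proof.
rewrite -[tofrac n]divr1 -(rmorph1 tofrac) frac_ext_div ?oner_neq0 //.
by rewrite rmorph1 divr1.
Qed.

Let ext_zmod : zmod_morphism frac_ext.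
Proof.
move=> x y; have [dx dy] := (fden_neq0 x, fden_neq0 y).
have dxy : fden x * fden y != 0 by rewrite mulf_neq0.
have -> : x - y = tofrac (fnum x * fden y - fnum y * fden x)
                  / tofrac (fden x * fden y).
  rewrite {1}[x]fractionE {1}[y]fractionE.
  rewrite -(fraction_scale (fnum x) _ dy) -(fraction_scale (fnum y) _ dx).
  by rewrite [fden y * _]mulrC -mulrBl -rmorphB.
rewrite frac_ext_div // rmorphB !rmorphM /= mulrBl /frac_ext.
have [fx fy] := (f_inj dx, f_inj dy).
rewrite -mulf_div divff // mulr1 [f (fden x) * _]mulrC.
by rewrite -mulf_div divff // mulr1.
Qed.

Let ext_monoid : monoid_morphism frac_ext.
Proof.
split; first by rewrite -(rmorph1 tofrac) frac_ext_tofrac rmorph1.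
move=> x y; have [dx dy] := (fden_neq0 x, fden_neq0 y).
have dxy : fden x * fden y != 0 by rewrite mulf_neq0.
have -> : x * y = tofrac (fnum x * fnum y) / tofrac (fden x * fden y).
  by rewrite {1}[x]fractionE {1}[y]fractionE mulf_div -!rmorphM.
by rewrite frac_ext_div // !rmorphM /= -mulf_div.
Qed.

Definition frac_extension : {rmorphism {fraction A} -> L} :=
  HB.pack frac_ext (GRing.isZmodMorphism.Build _ _ _ ext_zmod)
    (GRing.isMonoidMorphism.Build _ _ _ ext_monoid).

End FractionExtension.

Lemma Kmap_symb (k k' : fieldType) (j : {rmorphism k -> k'}) c : c != 0 ->
  Kmap j (milnor_steinberg k c) = milnor_steinberg k' (j c).
Proof.
move=> c0; pose c' : nz k := exist (fun x => x != 0) c c0.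
have -> : milnor_steinberg k c = Ksymbol c' by rewrite -symb_val.
by rewrite Kmap_symbol -symb_val.
Qed.

Section Substitution.
Variables (k k' : fieldType) (j : {rmorphism k -> k'}) (u : nz k').
Local Notation "{@ a }" := (milnor_steinberg _ a) (format "{@ a }").
Let uX : {poly k'} := val u *: 'X.

Let subst_poly (p : {poly k}) : {poly k'} := map_poly j p \Po uX.

Let size_uX : size uX = 2%N.
Proof. by rewrite size_scale ?size_polyX //; exact: (valP u). Qed.

Let lead_uX : lead_coef uX = val u.
Proof. by rewrite lead_coefZ lead_coefX mulr1. Qed.

Let size_subst p : size (subst_poly p) = size p.
Proof. by rewrite size_comp_poly2 ?size_uX // size_map_poly. Qed.

Let lead_subst p :
  lead_coef (subst_poly p) = j (lead_coef p) * val u ^+ (size p).-1.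
Proof.
by rewrite lead_coef_comp ?size_uX // lead_coef_map lead_uX size_map_poly.
Qed.

Let subst_frac : {rmorphism {poly k} -> {fraction {poly k'}}} :=
  @FracField.tofrac {poly k'} \o (comp_poly uX \o map_poly j).

Let subst_frac_neq0 p : p != 0 -> subst_frac p != 0.
Proof.
by move=> p0; rewrite tofrac_eq0 -size_poly_eq0 size_subst size_poly_eq0.
Qed.

(** The embedding of [k(t)] into [k'(s)] that extends [j] and sends [t] to
    [u s]. *)
Definition subst : {rmorphism {fraction {poly k}} -> {fraction {poly k'}}} :=
  frac_extension subst_frac_neq0.

Lemma subst_fracC c : subst (fracC k c) = fracC k' (j c).
Proof.
rewrite [LHS](frac_ext_tofrac subst_frac_neq0) /= /comp /=.
by rewrite map_polyC comp_polyC.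
Qed.

Lemma subst_fracX : subst (val (fracX k)) = fracC k' (val u) * val (fracX k').
Proof.
rewrite [LHS](frac_ext_tofrac subst_frac_neq0) /= /comp /=.
by rewrite map_polyX comp_polyX /uX -mul_polyC rmorphM.
Qed.

Lemma symb_subst p : p != 0 ->
  poly_sym (milnor_steinberg k') 0 (subst_poly p) =
  poly_sym (steinberg_comp (Kmap j) (milnor_steinberg k)) (Ksymbol u) p.
Proof.
move=> p0; rewrite /poly_sym mul0rn addr0 lead_subst.
have u0 : val u != 0 by exact: (valP u).
have l0 : lead_coef p != 0 by rewrite lead_coef_eq0.
have jl0 : j (lead_coef p) != 0 by rewrite fmorph_eq0.
rewrite steinbergM ?expf_neq0 //; congr (_ + _).
  by rewrite -Kmap_symb.
elim: (size p).-1 => [|n IH]; first by rewrite mulr0n steinberg1.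
by rewrite exprS steinbergM ?expf_neq0 // IH mulrS -symb_val.
Qed.

(** The leading term [c t^d] of a polynomial becomes [c u^d s^d], whose
    specialization is [{c} + d {u}]: the expansion applies with [{u}] as the
    value of the variable. *)
Lemma specialize_subst x : specialize (Kmap subst x) =
  Kmap j (total_residue x 0 0) + Kmap j (residue x) * Ksymbol u.
Proof.
have u0 : val u != 0 by exact: (valP u).
apply: (residue_expansion (T := @specialize k' \o Kmap subst)) => [c c0||v].
- have jc0 : j c != 0 by rewrite fmorph_eq0.
  have := steinberg_anticomm (milnor_steinberg k') u0 jc0.
  by rewrite -Kmap_symb // [milnor_steinberg k' (val u)]symb_val.
- have := steinberg_sqr (milnor_steinberg k') u0.
  have <- : Kmap j {@-1} = {@-1}.
    by rewrite Kmap_symb ?rmorphN1 // oppr_eq0 oner_neq0.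
  by rewrite [milnor_steinberg k' (val u)]symb_val.
have [n0 d0] := (fnum_neq0 (valP v), fden_neq0 (val v)).
rewrite /= Kmap_symbol specialize_symbol.
rewrite [val (nz_map _ _)]/(frac_ext subst_frac (val v)) /frac_ext /=.
have c0 p : p != 0 -> subst_poly p != 0.
  by rewrite -!size_poly_eq0 size_subst.
rewrite [LHS]frac_sym_div; try by apply: c0.
by rewrite /frac_sym !symb_subst.
Qed.

End Substitution.

(** * Additive operations in one variable *)

Section OneVariable.
Variable k0 : fieldType.
Variable phi : forall k : fieldType, {rmorphism k0 -> k} -> nz k -> milnorK k.
Hypothesis phi_nat : forall (k k' : fieldType)
  (j : {rmorphism k0 -> k}) (j' : {rmorphism k0 -> k'})
  (f : {rmorphism k -> k'}), f \o j =1 j' ->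
  forall u, phi j' (nz_map f u) = Kmap f (phi j u).
Hypothesis phi_add : forall (k : fieldType) (j : {rmorphism k0 -> k})
  (a b c : nz k), val c = val a * val b -> phi j c = phi j a + phi j b.

(** Compare [phi] at [u s] and at [s] in [k(s)]: both are images of its value at
    [t] in [k0(t)], and their specializations differ by [residue * {u}]. *)
Lemma additive_on_units (k : fieldType) (j : {rmorphism k0 -> k}) (u : nz k) :
  phi j u = Kmap j (residue (phi (fracC k0) (fracX k0))) * Ksymbol u.
Proof.
set a := phi _ (fracX k0).
pose jk : {rmorphism k0 -> {fraction {poly k}}} := fracC k \o j.
pose one_k : nz k := exist (fun x => x != 0) 1 (oner_neq0 k).
have subst_a v : phi jk (nz_map (subst j v) (fracX k0)) = Kmap (subst j v) a.
  by apply: phi_nat => c; rewrite /= [LHS]subst_fracC.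
have sum : Kmap (subst j u) a =
    Kmap (fracC k) (phi j u) + Kmap (subst j one_k) a.
  rewrite -(phi_nat (j' := jk)) // -!subst_a; apply: phi_add.
  have sX v : val (nz_map (subst j v) (fracX k0)) =
      fracC k (val v) * val (fracX k).
    exact: subst_fracX.
  have := sX one_k; rewrite [val one_k]/(1 : k) (rmorph1 (fracC k)) mul1r.
  move: (sX u); move: (nz_map _ _) (nz_map _ _) => U V UE VE.
  by rewrite UE VE.
have := congr1 (@specialize k) sum.
rewrite [RHS](rmorphD (@specialize k)).
rewrite [X in _ = X + _](specialize_fracC (phi j u)).
rewrite (specialize_subst j u a).
rewrite [X in _ = _ + X](specialize_subst j one_k a).
have -> : Ksymbol one_k = 0.
  by rewrite -[Ksymbol _]symb_val; exact: (steinberg1 (milnor_steinberg k)).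
by rewrite mulr0 addr0 addrC => /addIr ->.
Qed.

End OneVariable.

(** * Multiadditive natural families *)

Lemma Kmap_id (k : fieldType) (x : milnorK k) : Kmap idfun x = x.
Proof.
elim/milnorK_ind: x => [||u|x IHx|x y IHx IHy|x y IHx IHy].
- by rewrite rmorph0.
- by rewrite rmorph1.
- by rewrite Kmap_symbol; congr Ksymbol; apply: val_inj.
- by rewrite rmorphN /= IHx.
- by rewrite rmorphD /= IHx IHy.
- by rewrite rmorphM /= IHx IHy.
Qed.

Lemma nz_map_id (k : fieldType) (s : seq (nz k)) : map (nz_map idfun) s = s.
Proof. by apply: map_id_in => u _; apply: val_inj. Qed.

Lemma Kmap_prod (k k' : fieldType) (f : {rmorphism k -> k'}) (s : seq (nz k)) :
  Kmap f (\prod_(u <- s) Ksymbol u) = \prod_(u <- map (nz_map f) s) Ksymbol u.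
Proof.
by rewrite rmorph_prod big_map; apply: eq_bigr => u _; exact: Kmap_symbol.
Qed.

(** Families are defined on sequences of all lengths but constrained only in
    length [i], so that a variable can be appended without dependent types. *)
Definition natural_at (k0 : fieldType) (i : nat)
    (phi : forall k : fieldType,
       {rmorphism k0 -> k} -> seq (nz k) -> milnorK k) :=
  forall (k k' : fieldType)
    (j : {rmorphism k0 -> k}) (j' : {rmorphism k0 -> k'})
    (f : {rmorphism k -> k'}), f \o j =1 j' ->
  forall s, size s = i -> phi k' j' (map (nz_map f) s) = Kmap f (phi k j s).

Definition multiadditive_at (k0 : fieldType) (i : nat)
    (phi : forall k : fieldType,
       {rmorphism k0 -> k} -> seq (nz k) -> milnorK k) :=
  forall (k : fieldType) (j : {rmorphism k0 -> k})
    (s1 s2 : seq (nz k)) (a b c : nz k),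
  (size s1 + size s2).+1 = i -> val c = val a * val b ->
  phi k j (s1 ++ c :: s2) = phi k j (s1 ++ a :: s2) + phi k j (s1 ++ b :: s2).

(** Freezing all variables but the last over [k] gives an operation in one
    variable over [k], which is multiplication by a coefficient in [K_*(k)].  As
    a residue this coefficient is additive in the frozen variables, and it is
    natural because it is determined by the operation. *)
Lemma multiadditive_natural (k0 : fieldType) (i : nat)
    (phi : forall k : fieldType,
       {rmorphism k0 -> k} -> seq (nz k) -> milnorK k) :
  natural_at i phi -> multiadditive_at i phi ->
  exists a : milnorK k0,
  forall (k : fieldType) (j : {rmorphism k0 -> k}) s, size s = i ->
    phi k j s = Kmap j a * \prod_(u <- s) Ksymbol u.
Proof.
elim: i phi => [|i IH] phi phi_nat phi_add.
  exists (phi k0 idfun [::]) => k j [] // _.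
  by rewrite big_nil mulr1 -(phi_nat _ _ idfun j j).
have phi_ext (k : fieldType) (j j' : {rmorphism k0 -> k}) s :
    j =1 j' -> size s = i.+1 -> phi k j s = phi k j' s.
  move=> jj' si; rewrite -[s in RHS]nz_map_id (phi_nat _ _ j j' idfun) //.
  by rewrite Kmap_id.
pose adjoin_X (k : fieldType) (s : seq (nz k)) :=
  rcons (map (nz_map (fracC k)) s) (fracX k).
pose psi (k : fieldType) (j : {rmorphism k0 -> k}) (s : seq (nz k))
    : milnorK k :=
  residue (phi _ (fracC k \o j) (adjoin_X k s)).
have psiP (k : fieldType) (j : {rmorphism k0 -> k}) s
    (k' : fieldType) (f : {rmorphism k -> k'}) u :
    size s = i -> phi k' (f \o j) (rcons (map (nz_map f) s) u)
                  = Kmap f (psi k j s) * Ksymbol u.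
  move=> si.
  pose phi1 (k1 : fieldType) (f1 : {rmorphism k -> k1}) (u1 : nz k1) :=
    phi k1 (f1 \o j) (rcons (map (nz_map f1) s) u1).
  apply: (additive_on_units (phi := phi1))
    => [k1 k2 f1 f2 g gf v|k1 f1 a b c cab].
    rewrite /phi1 -(phi_nat _ _ (f1 \o j) (f2 \o j) g); first last.
    - by rewrite size_rcons size_map si.
    - by move=> x /=; rewrite -gf.
    rewrite map_rcons -map_comp; congr (phi _ _ (rcons _ _)).
    by apply: eq_map => x; apply: val_inj; rewrite /= -gf.
  by rewrite /phi1 -!cats1; apply: phi_add; rewrite ?size_map ?si ?addn0.
have [||a aP] := IH psi.
- move=> k k' j j' f fj s si.
  rewrite -[RHS]residue_fracCX /psi; congr residue.
  rewrite -(Kmap_comp (j' := fracC k' \o f)) // -psiP // /adjoin_X -map_comp.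
  rewrite (phi_ext _ (fracC k' \o j') ((fracC k' \o f) \o j)); first last.
  - by rewrite size_rcons size_map si.
  - by move=> x /=; rewrite -fj.
  by congr (phi _ _ (rcons _ _)); apply: eq_map => x; apply: val_inj.
- move=> k j s1 s2 u v w si wuv.
  rewrite /psi -residueD /adjoin_X !map_cat /= !rcons_cat /=; congr residue.
  apply: phi_add; first by rewrite size_rcons !size_map addnS si.
  by rewrite /= wuv !rmorphM.
exists a => k j s; case/lastP: s => // s u; rewrite size_rcons => -[si].
rewrite -cats1 big_cat big_seq1 mulrA /= -aP // cats1.
rewrite -[psi k j s]Kmap_id -psiP // nz_map_id.
by apply: phi_ext; rewrite ?size_rcons ?si.
Qed.

(** The residue at a new variable removes the last factor of the product. *)
Lemma scalar_unique (k0 : fieldType) (i : nat) (a : milnorK k0) :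
  (forall (k : fieldType) (j : {rmorphism k0 -> k}) (s : seq (nz k)),
     size s = i -> Kmap j a * \prod_(u <- s) Ksymbol u = 0) -> a = 0.
Proof.
elim: i => [|i IH] a0.
  by have := a0 k0 idfun [::] erefl; rewrite big_nil mulr1 Kmap_id.
apply: IH => k j s si.
rewrite -[LHS]residue_fracCX rmorphM /= Kmap_prod.
rewrite -(Kmap_comp (j' := fracC k \o j)) // -mulrA.
have := a0 _ (fracC k \o j) (rcons (map (nz_map (fracC k)) s) (fracX k)).
rewrite size_rcons size_map si -cats1 big_cat big_seq1 => -> //.
by rewrite /residue rmorph0 mxE.
Qed.

(** * Additive operations on [K_i] *)

Section Operations.
Variables (k0 : fieldType) (i : nat).

(** The default value is taken only when [size s] differs from [i]. *)
Definition symbol_prod (k : fieldType) (s : seq (nz k)) : milnorKn k i :=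
  insubd 0 (\prod_(u <- s) Ksymbol u).

Lemma symbol_prodE (k : fieldType) (s : seq (nz k)) : size s = i ->
  Kn_val (symbol_prod s) = \prod_(u <- s) Ksymbol u.
Proof.
move=> si; rewrite /symbol_prod [LHS]insubdK //.
apply/boolp.asboolP; exists [:: (1, Tuple (introT eqP si))].
by rewrite big_seq1.
Qed.

Lemma milnorKn_span (k : fieldType) (x : milnorKn k i) :
  exists r : seq (int * i.-tuple (nz k)),
    x = \sum_(p <- r) symbol_prod p.2 *~ p.1.
Proof.
have /boolp.asboolP[r xr] := Kn_valP x.
exists r; apply: val_inj; rewrite [LHS]xr raddf_sum.
apply: eq_bigr => p _; rewrite [RHS]raddfMz; congr (_ *~ _).
by apply/esym/symbol_prodE; rewrite size_tuple.
Qed.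

Variable phi : operation k0 i.
Hypothesis phi_add : op_is_additive phi.

Lemma op_zmod_morphism (k : fieldType) (j : {rmorphism k0 -> k}) :
  zmod_morphism (phi k j).
Proof.
move=> x y; apply: (addIr (phi k j y)).
by rewrite -phi_add !subrK.
Qed.

Lemma additive_op_scalar : exists a : milnorK k0,
  forall (k : fieldType) (j : {rmorphism k0 -> k}) (x : milnorKn k i),
    phi k j x = Kmap j a * Kn_val x.
Proof.
pose psi (k : fieldType) (j : {rmorphism k0 -> k}) (s : seq (nz k)) :=
  phi k j (symbol_prod s).
have [||a aP] := @multiadditive_natural k0 i psi.
- move=> k k' j j' f fj s si; rewrite /psi -(op_natural phi fj).
  congr (phi _ _ _).
  by apply: val_inj; rewrite /= !symbol_prodE ?size_map // Kmap_prod.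
- move=> k j s1 s2 u v w si wuv; rewrite /psi -phi_add.
  congr (phi _ _ _).
  have sz t : size (s1 ++ t :: s2) = i by rewrite size_cat addnS.
  apply: val_inj; rewrite [RHS]raddfD [LHS]symbol_prodE //.
  rewrite [X in _ = X + _]symbol_prodE // [X in _ = _ + X]symbol_prodE //.
  by rewrite !big_cat !big_cons /= (KsymbolM wuv) mulrDl mulrDr.
exists a => k j x; have [r ->] := milnorKn_span x.
pose phi_mor : {additive milnorKn k i -> milnorK k} :=
  HB.pack (phi k j) (GRing.isZmodMorphism.Build _ _ _ (op_zmod_morphism j)).
rewrite [LHS](raddf_sum phi_mor) -[Kn_val _]/(val _) raddf_sum mulr_sumr.
apply: eq_bigr => p _.
rewrite [LHS](raddfMz phi_mor) [X in _ = _ * X]raddfMz mulrzAr; congr (_ *~ _).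
by rewrite [LHS]aP ?size_tuple // [X in _ = _ * X]symbol_prodE ?size_tuple.
Qed.

End Operations.

Unset Implicit Arguments.

Theorem proposition3p21 (k0 : fieldType) (i : nat) :
  (forall a : milnorK k0, op_is_additive (op_scale a (op_id k0 i))) /\
  (forall phi : operation k0 i, op_is_additive phi ->
     exists! a : milnorK k0,
       forall (k : fieldType) (j : {rmorphism k0 -> k}) (x : milnorKn k i),
         phi k j x = op_scale a (op_id k0 i) k j x).
Proof.
split=> [a k j x y|phi phi_add]; first exact: mulrDr.
have [a aP] := additive_op_scalar phi_add.
exists a; split=> // b bP; apply/eqP; rewrite -subr_eq0; apply/eqP.
apply: (@scalar_unique k0 i) => k j s si.
rewrite rmorphB /= mulrBl -(symbol_prodE si).
by rewrite -[X in X - _]aP -[X in _ - X]bP subrr.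
Qed.
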